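(* In the propositional logic $L_{\rm LEA}$ the following hold for all formulas $\varphi,\psi,\chi$: (a) $\varphi\rightarrow\psi,\psi\rightarrow\chi\vdash\varphi\rightarrow\chi$; (b) $\vdash\varphi\rightarrow1$; (c) $\vdash\varphi\rightarrow\varphi$; (d) $\vdash\psi\rightarrow(\psi\vee\varphi)$; (e) $\vdash\neg\neg\varphi\leftrightarrow\varphi$; (f) $\varphi\rightarrow\psi\vdash(\neg\varphi\rightarrow\neg\psi)\leftrightarrow(\psi\rightarrow\varphi)$; (g) $\vdash\psi\rightarrow(\varphi\vee\psi)$ and $\vdash(\varphi\vee\psi)\leftrightarrow(\psi\vee\varphi)$; (h) $\varphi\rightarrow\psi,\chi\rightarrow\psi\vdash(\varphi\vee\chi)\rightarrow\psi$; (i) $\vdash(\varphi\rightarrow\psi)\leftrightarrow((\varphi\vee\psi)\rightarrow\psi)$; (j) $\vdash(\neg\varphi\rightarrow\neg(\psi\vee\varphi))\leftrightarrow(\psi\rightarrow\varphi)$.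
   Context: Formulas are built from propositional variables using a binary connective $\rightarrow$ and a constant $0$. Abbreviations: $\neg\varphi:=\varphi\rightarrow0$, $1:=\neg0=0\rightarrow0$, $\psi\vee\varphi:=(\psi\rightarrow\varphi)\rightarrow\varphi$. The logic $L_{\rm LEA}$ is the consequence relation $\vdash$ of the deductive system with axiom schemes (A1) $\varphi\rightarrow(\psi\rightarrow\varphi)$; (A2) $((\varphi\rightarrow\psi)\rightarrow\psi)\rightarrow((\psi\rightarrow\varphi)\rightarrow\varphi)$; (A3) $0\rightarrow\varphi$; and inference rules (MP) $\varphi,\varphi\rightarrow\psi\vdash\psi$; (Sf) $\varphi\rightarrow\psi\vdash(\psi\rightarrow\chi)\rightarrow(\varphi\rightarrow\chi)$; (WPf) $\varphi\rightarrow\psi,\psi\rightarrow\varphi\vdash(\chi\rightarrow\varphi)\rightarrow(\chi\rightarrow\psi)$; (R1) $\varphi\rightarrow\psi\vdash(\neg\varphi\rightarrow\neg\psi)\rightarrow(\psi\rightarrow\varphi)$; (R2) $\varphi\rightarrow\neg\psi,(\neg\varphi\rightarrow\psi)\rightarrow\neg\chi\vdash(\neg(\neg\varphi\rightarrow\psi)\rightarrow\chi)\rightarrow(\neg\varphi\rightarrow(\neg\psi\rightarrow\chi))$. That is, $\Gamma\vdash\varphi$ iff $\varphi$ is derivable from $\Gamma$ and instances of the axioms by the rules. $\Gamma\vdash\alpha\leftrightarrow\beta$ abbreviates: $\Gamma\vdash\alpha\rightarrow\beta$ and $\Gamma\vdash\beta\rightarrow\alpha$. *)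

(* Defs.v *)
From Stdlib Require Export Ensembles.

Set Implicit Arguments.

Declare Scope lea_scope.
Delimit Scope lea_scope with lea.

(* [V] is the type of propositional variables. *)
Inductive formula (V : Type) : Type :=
| Var (v : V)
| Bot
| Imp (p q : formula V).

Arguments Var {V} v.
Arguments Bot {V}.
Arguments Imp {V} p q.
Bind Scope lea_scope with formula.

Notation "p --> q" := (Imp p q) (at level 55, right associativity) : lea_scope.
Local Open Scope lea_scope.

Definition neg (V : Type) (p : formula V) : formula V := p --> Bot.
Definition top {V : Type} : formula V := neg Bot.
Definition disj (V : Type) (p q : formula V) : formula V := (p --> q) --> q.

Notation "p \V q" := (disj p q) (at level 50, left associativity) : lea_scope.

Reserved Notation "G |-- p" (at level 70, no associativity).

Inductive derives (V : Type) (G : Ensemble (formula V)) : formula V -> Prop :=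
| Hyp p : In _ G p -> G |-- p
| A1 p q : G |-- p --> (q --> p)
| A2 p q : G |-- ((p --> q) --> q) --> ((q --> p) --> p)
| A3 p : G |-- Bot --> p
| MP p q : G |-- p -> G |-- p --> q -> G |-- q
| Sf p q r : G |-- p --> q -> G |-- (q --> r) --> (p --> r)
| WPf p q r : G |-- p --> q -> G |-- q --> p -> G |-- (r --> p) --> (r --> q)
| R1 p q : G |-- p --> q -> G |-- (neg p --> neg q) --> (q --> p)
| R2 p q r :
    G |-- p --> neg q ->
    G |-- (neg p --> q) --> neg r ->
    G |-- (neg (neg p --> q) --> r) --> (neg p --> (neg q --> r))
where "G |-- p" := (derives G p%lea).

(* The biconditional is not a connective: it abbreviates two consequences. *)
Definition derives_iff (V : Type) (G : Ensemble (formula V)) (p q : formula V) :=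
  G |-- p --> q /\ G |-- q --> p.

Notation "G |-- p <--> q" := (derives_iff G p%lea q%lea)
  (at level 70, p at next level, q at next level, no associativity).
Notation "|-- p" := (derives (Empty_set _) p%lea) (at level 70).
Notation "|-- p <--> q" := (derives_iff (Empty_set _) p%lea q%lea)
  (at level 70, p at next level, q at next level).

(* Main.v *)
Require Import Defs.

Open Scope lea_scope.

(** Since [p \V q] unfolds to [(p --> q) --> q], (A2) is exactly its commutativity and (A1) puts [q]
    below it. Commuting and then discharging a derivable antecedent ([imp_discharge]) yields
    reflexivity, double negation and elimination of [\V]. [Sf] makes the arrow antitone on the left;
    with [neg_neg] this turns (R1) into the equivalence [contraposition]. An arbitrary [G] lets each
    lemma apply both with and without hypotheses. *)

Lemma imp_trans (V : Type) (G : Ensemble (formula V)) (p q r : formula V) :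
  G |-- p --> q -> G |-- q --> r -> G |-- p --> r.
Proof. intros Hpq Hqr. exact (MP Hqr (Sf r Hpq)). Qed.

Lemma imp_weaken (V : Type) (G : Ensemble (formula V)) (p q : formula V) :
  G |-- p -> G |-- q --> p.
Proof. intros Hp. exact (MP Hp (A1 G p q)). Qed.

Lemma imp_top (V : Type) (G : Ensemble (formula V)) (p : formula V) :
  G |-- p --> top.
Proof. apply imp_weaken. apply A3. Qed.

(* (A2) turns the weakening [q --> (p --> q) --> q] around. *)
Lemma imp_discharge (V : Type) (G : Ensemble (formula V)) (p q : formula V) :
  G |-- q -> G |-- (q --> p) --> p.
Proof.
  intros Hq. apply (MP (p := (p --> q) --> q)).
  - apply imp_weaken. exact Hq.
  - apply A2.
Qed.

(** The detour goes through [top --> p], whose antecedent is an instance of (A3) and so can be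
    discharged. *)
Lemma imp_refl (V : Type) (G : Ensemble (formula V)) (p : formula V) :
  G |-- p --> p.
Proof.
  apply imp_trans with (top --> p).
  - apply A1.
  - apply imp_discharge. apply A3.
Qed.

Lemma disj_comm (V : Type) (G : Ensemble (formula V)) (p q : formula V) :
  G |-- (p \V q) <--> (q \V p).
Proof. split; apply A2. Qed.

Lemma disj_intro_r (V : Type) (G : Ensemble (formula V)) (p q : formula V) :
  G |-- q --> (p \V q).
Proof. apply A1. Qed.

Lemma disj_intro_l (V : Type) (G : Ensemble (formula V)) (p q : formula V) :
  G |-- p --> (p \V q).
Proof.
  apply imp_trans with (q \V p).
  - apply disj_intro_r.
  - apply disj_comm.
Qed.

(* [neg (neg p)] is literally [p \V Bot]. *)
Lemma neg_neg (V : Type) (G : Ensemble (formula V)) (p : formula V) :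
  G |-- neg (neg p) <--> p.
Proof.
  split.
  - apply imp_trans with (Bot \V p).
    + apply A2.
    + apply imp_discharge. apply A3.
  - apply disj_intro_l.
Qed.

(* The direction not given by (R1) is (R1) for [neg q --> neg p], up to double
   negations. *)
Lemma contraposition (V : Type) (G : Ensemble (formula V)) (p q : formula V) :
  G |-- p --> q -> G |-- (neg p --> neg q) <--> (q --> p).
Proof.
  intros Hpq. split.
  - apply R1. exact Hpq.
  - apply imp_trans with (neg (neg q) --> neg (neg p)).
    + apply imp_trans with (neg (neg q) --> p).
      * apply Sf. apply neg_neg.
      (* [WPf] replaces a consequent only by an equivalent one, so both halves of [neg_neg]
         enter. *)
      * apply WPf; apply neg_neg.
    + apply R1. apply Sf. exact Hpq.
Qed.

(** Two uses of [Sf] make [\V] monotone in its left argument, giving [q \V r]; commuted, this is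
    [(r --> q) --> q], whose antecedent is derivable. *)
Lemma disj_elim (V : Type) (G : Ensemble (formula V)) (p q r : formula V) :
  G |-- p --> q -> G |-- r --> q -> G |-- (p \V r) --> q.
Proof.
  intros Hpq Hrq. apply imp_trans with (q \V r).
  - apply Sf. apply Sf. exact Hpq.
  - apply imp_trans with (r \V q).
    + apply disj_comm.
    + apply imp_discharge. exact Hrq.
Qed.

Lemma imp_disj (V : Type) (G : Ensemble (formula V)) (p q : formula V) :
  G |-- (p --> q) <--> ((p \V q) --> q).
Proof.
  split.
  (* The right-hand side is literally [(p --> q) \V q]. *)
  - apply disj_intro_l.
  - apply Sf. apply disj_intro_l.
Qed.

(** As [p] lies below [q \V p], contraposition applies to this pair and both sides are equivalent to
    [(q \V p) --> p]. *)
Lemma neg_disj_imp (V : Type) (G : Ensemble (formula V)) (p q : formula V) :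
  G |-- (neg p --> neg (q \V p)) <--> (q --> p).
Proof.
  split; apply imp_trans with ((q \V p) --> p).
  - apply contraposition. apply disj_intro_r.
  - apply imp_disj.
  - apply imp_disj.
  - apply contraposition. apply disj_intro_r.
Qed.

Theorem theorem3p1 (V : Type) (phi psi chi : formula V) :
  (Couple _ (phi --> psi) (psi --> chi) |-- phi --> chi) /\
  (|-- phi --> top) /\
  (|-- phi --> phi) /\
  (|-- psi --> (psi \V phi)) /\
  (|-- neg (neg phi) <--> phi) /\
  (Singleton _ (phi --> psi) |-- (neg phi --> neg psi) <--> (psi --> phi)) /\
  ((|-- psi --> (phi \V psi)) /\ (|-- (phi \V psi) <--> (psi \V phi))) /\
  (Couple _ (phi --> psi) (chi --> psi) |-- (phi \V chi) --> psi) /\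
  (|-- (phi --> psi) <--> ((phi \V psi) --> psi)) /\
  (|-- (neg phi --> neg (psi \V phi)) <--> (psi --> phi)).
Proof.
  repeat match goal with |- _ /\ _ => split end.
  - apply imp_trans with psi; apply Hyp; constructor.
  - apply imp_top.
  - apply imp_refl.
  - apply disj_intro_l.
  - apply neg_neg.
  - apply contraposition. apply Hyp. constructor.
  - apply disj_intro_r.
  - apply disj_comm.
  - apply disj_elim; apply Hyp; constructor.
  - apply imp_disj.
  - apply neg_disj_imp.
Qed.
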